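(* Let $A$ be an analytic subset of $\mathrm{SRC}$. Then there exists $\mathbf{f}\in\mathrm{SRC}$ such that for every $\mathbf{g}\in A$, $\mathbf{g}$ strongly embeds into $\mathbf{f}$.
   Context: For a compact metrizable space $X$, let $C(X)$ be the Banach space of continuous real functions on $X$ with the supremum norm, $B(X)$ its closed unit ball, and $\mathcal{B}_1(X)$ the set of real-valued Baire-1 functions on $X$. For $\mathcal{F}\subseteq\mathbb{R}^X$, $\overline{\mathcal{F}}^p$ denotes the closure of $\mathcal{F}$ in $\mathbb{R}^X$ (pointwise topology). Define $\mathrm{SRC}(X)=\{(f_n)\in B(X)^{\mathbb{N}}: \overline{\{f_n\}}^p\subseteq\mathcal{B}_1(X) \text{ and } f_n\neq f_m \text{ for } n\neq m\}$, regarded as a subset of the Polish space $B(X)^{\mathbb{N}}$ (product of the norm topologies), and $\mathrm{SRC}=\mathrm{SRC}(2^{\mathbb{N}})$, where $2^{\mathbb{N}}$ is the Cantor set. For compact metrizable $X,Y$, $\mathbf{f}=(f_n)\in\mathrm{SRC}(X)$ and $\mathbf{g}=(g_n)\in\mathrm{SRC}(Y)$, we say $\mathbf{g}$ strongly embeds into $\mathbf{f}$ if (a) there is a homeomorphic embedding of $\overline{\{g_n\}}^p$ into $\overline{\{f_n\}}^p$, and (b) for every $\varepsilon>0$ there is an infinite set $L_\varepsilon=\{l_0<l_1<\dots\}\subseteq\mathbb{N}$ such that for every $k\in\mathbb{N}$ and all $a_0,\dots,a_k\in\mathbb{R}$, $$\Big|\max_{0\le i\le k}\big\|\sum_{n=0}^i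 a_n g_n\big\|_\infty-\big\|\sum_{n=0}^k a_n f_{l_n}\big\|_\infty\Big|\le\varepsilon\sum_{n=0}^k\frac{|a_n|}{2^{n+1}}.$$ *)

(* Defs.v *)
From HB Require Import structures.
From mathcomp Require Import all_boot all_order all_algebra.
From mathcomp Require Import all_classical all_reals all_analysis.
Set Implicit Arguments.
Unset Strict Implicit.
Unset Printing Implicit Defensive.
Import Order.TTheory GRing.Theory Num.Theory.
Import numFieldTopology.Exports.
Local Open Scope classical_set_scope.
Local Open Scope ring_scope.

Definition separable (T : topologicalType) : Prop :=
  exists2 D : set T, countable D & dense D.

(* The library's completePseudoMetricType is pointed, hence never empty, so
   completeness is stated here for an arbitrary metricType. *)
Definition complete_metric (R : realType) (Y : metricType R) : Prop :=
  forall F : set_system Y, ProperFilter F -> cauchy F -> exists y : Y, F --> y.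

(* A Polish space is a space Y with a separable complete metric; a set is
   analytic when it is a continuous image of such a Y (Y empty is allowed). *)
Definition analytic (R : realType) (Z : topologicalType) (A : set Z) : Prop :=
  exists (Y : metricType R) (h : Y -> Z),
    [/\ separable Y, complete_metric Y, continuous h & range h = A].

Definition homeomorphic_embedding (S T : topologicalType) (h : S -> T) : Prop :=
  [/\ injective h, continuous h &
      forall U : set S, open U ->
        exists2 V : set T, open V & h @` U = range h `&` V].

(* For X compact and nonempty and f continuous this is the maximum of |f|. *)
Definition supnorm (R : realType) (X : Type) (f : X -> R) : R :=
  sup (range (fun x => `|f x|)).

Definition baire1 (R : realType) (X : topologicalType) : set (X -> R) :=
  [set f | exists2 u : nat -> X -> R,
      forall n, continuous (u n) & forall x, u n x @[n --> \oo] --> f x].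

(* The closed unit ball of C(X). *)
Definition unit_ball (R : realType) (X : topologicalType) :
    set {uniform X -> R} :=
  [set f : X -> R | continuous f /\ forall x, `|f x| <= 1].

(* B(X)^N: each factor has the topology of uniform convergence, i.e. that of
   the sup norm. *)
Definition ball_seq (R : realType) (X : topologicalType) : topologicalType :=
  prod_topology (fun _ : nat => set_type (@unit_ball R X)).

Definition seq_fun (R : realType) (X : topologicalType) (f : ball_seq R X)
  (n : nat) : X -> R := set_val (f n).

Definition ptws_closure (R : realType) (X : topologicalType)
    (f : ball_seq R X) : set {ptws X -> R} :=
  closure (range (seq_fun f) : set {ptws X -> R}).

Definition SRC (R : realType) (X : topologicalType) : set (ball_seq R X) :=
  [set f | ptws_closure f `<=` @baire1 R X /\ injective (seq_fun f)].

Definition strongly_embeds (R : realType) (X Y : topologicalType)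
    (g : ball_seq R Y) (f : ball_seq R X) : Prop :=
  (exists h : set_type (ptws_closure g) -> set_type (ptws_closure f),
      homeomorphic_embedding h) /\
  (forall eps : R, 0 < eps ->
    (* the infinite set L_eps is given by its increasing enumeration *)
    exists2 l : nat -> nat, {homo l : m n / (m < n)%N} &
      forall (k : nat) (a : nat -> R),
        (* the norms are nonnegative, so 0 is a harmless seed for the max *)
        `| \big[Num.max/0]_(i < k.+1)
              supnorm (fun y => \sum_(n < i.+1) a n * seq_fun g n y)
           - supnorm (fun x => \sum_(n < k.+1) a n * seq_fun f (l n) x) |
        <= eps * \sum_(n < k.+1) `|a n| / 2 ^+ n.+1).

(* Main.v *)
Require Import Defs.
From mathcomp Require Import all_boot all_order all_algebra.
From mathcomp Require Import all_classical all_reals all_analysis.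
From mathcomp Require Import lra.
Set Implicit Arguments.
Unset Strict Implicit.
Unset Printing Implicit Defensive.
Import Order.TTheory GRing.Theory Num.Theory.
Import numFieldNormedType.Exports.
Local Open Scope classical_set_scope.
Local Open Scope ring_scope.

(* Put functions [H t] on the nodes [t] of the tree of finite sequences of
   naturals, and let [f t] be [H t] times the indicator of the clopen set of
   those [sigma] in the Cantor set that run through [t], a function of the pair
   [(x, sigma)].  Along a branch [t_0, t_1, ...], a point [sigma] sees an initial
   segment of the branch, so the norm of [\sum_(n <= k) a_n f_(t_n)] is the
   maximum of the norms of the partial sums [\sum_(n <= i) a_n H_(t_n)].
   A limit point of the family [f] is zero, or it lives on a single slice
   [sigma = sigma_0], where it is a limit point of [H] along the branch
   [sigma_0]; hence [f] is in SRC as soon as these are all Baire-1.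
   Write the analytic set as the image of a Polish space [Y] under [h], label the
   nodes by a dense sequence of [Y], and let [H t] be the [n]-th term of [h y],
   [y] the last label and [n] the depth of [t].  Allowing only sequences of labels
   that converge, with matching terms of [h], every branch defines some [y] in
   [Y], and [H] along it is asymptotic to [h y], which is in SRC; conversely
   every [h y] is approximated to any accuracy along some branch. *)

(** * The pointwise topology through finite sets of points *)

Section Pointwise.
Context {R : realType} {X : topologicalType}.
Implicit Types p q : {ptws X -> R}.

Definition close_on (s : seq X) (e : R) (p q : {ptws X -> R}) :=
  forall x, x \in s -> `|q x - p x| < e.

Lemma ptws_nbhsP p (P : set {ptws X -> R}) :
  nbhs (p : {ptws X -> R}) P <->
  exists s e, 0 < e /\ forall q, close_on s e p q -> P q.
Proof.
split; last first.
  case=> s [e [e0 sP]]; apply: (@filterS _ (nbhs (p : {ptws X -> R})) _ _ _ sP) => {sP}.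
  elim: s => [|x s IHs]; first by apply: filterS filterT => q _ x; rewrite in_nil.
  have nx : \forall q \near (p : {ptws X -> R}), `|q x - p x| < e.
    have pe : nbhs (p x) [set y | `|y - p x| < e].
      by apply/nbhs_ballP; exists e => //= y; rewrite -ball_normE /= distrC.
    exact: (@proj_continuous X (fun=> R) x p _ pe).
  apply: filterS2 IHs nx => q sq xq y; rewrite inE => /orP[/eqP->//|]; exact: sq.
(* [G] consists of the sets containing a box around [p]. It converges to [p] in each coordinate,
   hence in the product, so it contains every neighbourhood of [p]. *)
pose G : set_system {ptws X -> R} :=
  [set P : set {ptws X -> R} | exists s e, 0 < e /\ forall q, close_on s e p q -> P q].
have FG : Filter G.
  split.
  - by exists [::], 1; split.
  - move=> A B [s [e [e0 sA]]] [t [d [d0 tB]]].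
    exists (s ++ t), (Num.min e d); split; first by rewrite lt_min e0.
    move=> q stq; split; [apply: sA|apply: tB] => x xs.
      have := stq x; rewrite mem_cat xs => /(_ isT).
      by rewrite lt_min => /andP[].
    have := stq x; rewrite mem_cat xs orbT => /(_ isT).
    by rewrite lt_min => /andP[].
  - move=> A B AB [s [e [e0 sA]]]; exists s, e; split => // q sq.
    exact/AB/sA.
have Gp : G --> (p : {ptws X -> R}).
  apply/cvg_sup => x; apply/cvg_image.
    by rewrite eqEsubset; split => // y _; exists (fun=> y).
  move=> A /nbhs_ballP[e /= e0 eA].
  exists [set q : {ptws X -> R} | A (q x)].
    exists [:: x], e; split => // q /(_ x); rewrite inE eqxx => /(_ isT) qx.
    by apply: eA; rewrite /ball /= distrC.
  rewrite eqEsubset; split => [_ [q Aq <-]//|y Ay].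
  by exists (fun=> y).
by move=> /Gp.
Qed.

End Pointwise.

Section ClusterPoints.
Context {R : realType} {X : topologicalType}.
Implicit Types (p q : {ptws X -> R}) (u : nat -> {ptws X -> R}) (s : seq X) (e : R).

Lemma close_onW s t e d p q : {subset s <= t} -> d <= e ->
  close_on t d p q -> close_on s e p q.
Proof. by move=> st de tpq x /st /tpq /lt_le_trans; apply. Qed.

Lemma close_onI s t e d p q : close_on (s ++ t) (Num.min e d) p q ->
  close_on s e p q /\ close_on t d p q.
Proof.
move=> stpq; split; apply: close_onW stpq.
- by move=> x xs; rewrite mem_cat xs.
- by rewrite ge_min lexx.
- by move=> x xs; rewrite mem_cat xs orbT.
- by rewrite ge_min lexx orbT.
Qed.

Lemma close_on_trans s e d p q r : close_on s e p q -> close_on s d q r ->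
  close_on s (e + d) p r.
Proof.
move=> spq sqr x xs; rewrite -(subrK (q x) (r x)) -addrA.
by rewrite addrC (le_lt_trans (ler_normD _ _))// ltrD ?spq ?sqr.
Qed.

Lemma closure_closeP (A : set {ptws X -> R}) p : closure A p <->
  forall s e, 0 < e -> exists2 q, A q & close_on s e p q.
Proof.
split=> [Ap s e e0|Ap B /ptws_nbhsP[s [e [e0 sB]]]].
  have /Ap[q [Aq sq]] : nbhs p (close_on s e p).
    by apply/ptws_nbhsP; exists s, e; split.
  by exists q.
by have [q Aq /sB Bq] := Ap s e e0; exists q.
Qed.

(** Clustering is counted by indices, not by values: a function equal to [u n] for infinitely many
    [n] in [S] qualifies. *)
Definition cluster_on (S : set nat) u p := forall s e N, 0 < e ->
  exists n, [/\ S n, (N <= n)%N & close_on s e p (u n)].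

Lemma cluster_on_closure S u p : cluster_on S u p -> closure (u @` S) p.
Proof.
move=> Sp; apply/closure_closeP => s e e0.
by have [n [Sn _ sn]] := Sp s e 0%N e0; exists (u n) => //; exists n.
Qed.

Lemma finite_separation u p N : exists s e, 0 < e /\
  forall m, (m < N)%N -> close_on s e p (u m) -> u m = p.
Proof.
elim: N => [|N [s [e [e0 sN]]]]; first by exists [::], 1; split.
have [uN|uN] := pselect (u N = p).
  exists s, e; split => // m; rewrite ltnS leq_eqVlt => /orP[/eqP-> //|].
  exact: sN.
have [x ux] : exists x, u N x != p x.
  apply: contrapT => /forallNP up; apply: uN; apply/funext => x.
  by apply/eqP/negPn/negP/up.
exists (s ++ [:: x]), (Num.min e `|u N x - p x|); split.
  by rewrite lt_min e0 normr_gt0 subr_eq0.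
move=> m + /close_onI[sm xm]; rewrite ltnS leq_eqVlt => /orP[/eqP mN|/sN]; last exact.
by have := xm x; rewrite mN mem_seq1 eqxx ltxx => /(_ isT).
Qed.

Lemma closure_seq S u p : closure (u @` S) p ->
  (exists2 n, S n & u n = p) \/ cluster_on S u p.
Proof.
move=> /closure_closeP Sp; apply: contrapT => /not_orP[nu].
apply => s e N e0; have [t [d [d0 tN]]] := finite_separation u p N.
have [_ [n Sn <-] /close_onI[sn tn]] := Sp (s ++ t) (Num.min e d)
  (ltac:(by rewrite lt_min e0)).
exists n; split => //; rewrite leqNgt; apply/negP => /tN/(_ tn) unp.
by apply: nu; exists n.
Qed.

(** Some box around [p] contains only finitely many terms, and a smaller one only terms equal to
    [p]. A point [q <> p] of the closure within half the smaller radius would be approached by terms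
    of the smaller box other than [p]. *)
Lemma isolated_in_closure u p : ~ cluster_on setT u p ->
  exists s e, 0 < e /\ forall q, closure (range u) q -> close_on s e p q -> q = p.
Proof.
move=> /existsNP[s /existsNP[e /existsNP[N /not_implyP[e0 /forallNP sN]]]].
have [t [d [d0 tN]]] := finite_separation u p N.
pose c := Num.min e d; have c0 : 0 < c / 2 by rewrite divr_gt0 ?lt_min ?e0.
exists (s ++ t), (c / 2); split => // q /closure_closeP uq stq.
apply: contrapT => qp; have [x qpx] : exists x, q x != p x.
  apply: contrapT => /forallNP qp'; apply: qp; apply/funext => x.
  by apply/eqP/negPn/negP/qp'.
have [_ [m _ <-] /close_onI[stm xm]] :=
  uq ((s ++ t) ++ [:: x]) (Num.min (c / 2) `|q x - p x|)
  (ltac:(by rewrite lt_min c0 normr_gt0 subr_eq0)).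
have := close_on_trans stq stm; rewrite -splitr => /close_onI[sm tm].
have [/tN/(_ tm) ump|Nm] := ltnP m N; last by apply: (sN m); split.
by have := xm x; rewrite ump mem_seq1 eqxx distrC ltxx => /(_ isT).
Qed.

End ClusterPoints.

(** * Embedding closures of sequences *)

Lemma compact_homeomorphic_embedding (S T : topologicalType) (A : set S)
    (B : set T) (F : S -> T) :
  compact A -> hausdorff_space T -> {within A, continuous F} ->
  {homo F : p / A p >-> B p} -> {in A &, injective F} ->
  exists h : set_type A -> set_type B, homeomorphic_embedding h.
Proof.
move=> cA hT cF FAB injF.
pose h (x : set_type A) : set_type B :=
  exist _ (F (set_val x)) (mem_set (FAB _ (set_valP x))).
have hE x : set_val (h x) = F (set_val x) by [].
have hinj : injective h.
  move=> x y /(congr1 set_val); rewrite !hE => /injF xy.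
  by apply: val_inj; apply: xy; apply: mem_set; exact: set_valP.
exists h; split => //.
  apply: continuous_comp_initial.
  have := (@subspace_sigL_continuousP _ A _ F).1 cF.
  by congr (continuous _); apply/funext => x; rewrite /= /sigL /=.
move=> U [U' oU' UE].
(* A continuous injection of a compact set into a Hausdorff space is closed: the image of [U] is cut
   out by the complement of the image of [A] minus [U']. *)
have cC : compact (A `&` ~` U').
  by apply: compact_closedI => //; exact: open_closedC.
exists (set_val @^-1` (~` (F @` (A `&` ~` U')))).
  exists (~` (F @` (A `&` ~` U'))) => //.
  apply: closed_openC; apply: compact_closed => //.
  apply: continuous_compact => //; apply: continuous_subspaceW cF.
  by move=> x [].
rewrite eqEsubset; split.
  move=> _ [x Ux <-]; split; first by exists x.
  rewrite /= hE => -[y [Ay Uy] Fyx]; apply: Uy.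
  have -> : y = set_val x by apply: injF => //; apply: mem_set => //; exact: set_valP.
  by move: Ux; rewrite -UE.
move=> _ [[x _ <-]] /= nFx; exists x => //; rewrite -UE.
apply: contrapT => nUx; apply: nFx; exists (set_val x) => //; split => //.
exact: set_valP.
Qed.

Section Embedding.
Context {R : realType} {X Z : topologicalType}.
Variables (u : nat -> {ptws X -> R}) (v : nat -> {ptws Z -> R}).
Variables (b : Z -> Prop) (r : Z -> X).

Definition on_slice (p : {ptws X -> R}) : {ptws Z -> R} :=
  fun z => if `[< b z >] then p (r z) else 0.

Hypothesis r_surj : forall x, exists2 z, b z & r z = x.
Hypothesis u_bounded : forall n x, `|u n x| <= 1.
Hypothesis u_inj : injective u.
Hypothesis v_inj : injective v.
Hypothesis v_neq : forall n p, v n <> on_slice p.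
Hypothesis v_asymp : forall z (e : R), 0 < e ->
  exists N, forall n, (N <= n)%N -> `|v n z - on_slice (u n) z| < e.

Let K := closure (range u).
Let limit_pt p := cluster_on setT u p.

Lemma on_slice_inj : injective on_slice.
Proof.
move=> p q pq; apply/funext => x; have [z bz <-] := r_surj x.
by have := congr1 (fun f => f z) pq; rewrite /on_slice asboolT.
Qed.

Lemma on_slice_dist p q z : `|on_slice q z - on_slice p z| <= `|q (r z) - p (r z)|.
Proof. by rewrite /on_slice; case: ifP => // _; rewrite subrr normr0. Qed.

(* Every limit point goes to its copy on the slice, even when it is some [u n]:
   sending such a [u n] to [v n] would break continuity. *)
Definition transfer (p : {ptws X -> R}) : {ptws Z -> R} :=
  if `[< limit_pt p >] then on_slice p
  else v (xget 0%N [set n | u n = p]).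

Lemma transfer_limit p : limit_pt p -> transfer p = on_slice p.
Proof. by move=> lp; rewrite /transfer asboolT. Qed.

Lemma transfer_isolated n : ~ limit_pt (u n) -> transfer (u n) = v n.
Proof.
move=> nl; rewrite /transfer asboolF //; congr v.
by apply: u_inj; apply: (@xgetPex _ 0%N [set m | u m = u n]); exists n.
Qed.

Lemma closure_cases p : K p -> limit_pt p \/ exists2 n, u n = p & ~ limit_pt (u n).
Proof.
move=> /closure_seq up; have [lp|nlp] := pselect (limit_pt p); first by left.
by case: up => // -[n _ unp]; right; exists n; rewrite ?unp.
Qed.

Lemma uniform_v_asymp (s : seq Z) (e : R) : 0 < e -> exists N, forall n, (N <= n)%N ->
  close_on s e (on_slice (u n)) (v n).
Proof.
move=> e0; elim: s => [|z s [N sN]]; first by exists 0%N => n _ x; rewrite in_nil.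
have [M zM] := v_asymp z e0; exists (maxn M N) => n.
rewrite geq_max => /andP[Mn Nn] x; rewrite inE => /orP[/eqP->|]; first exact: zM.
exact: sN.
Qed.

Lemma on_slice_limit p : limit_pt p -> cluster_on setT v (on_slice p).
Proof.
move=> lp s e N e0; have [M sM] := uniform_v_asymp s (e := e / 2) (ltac:(lra)).
have [n [_ Mn sn]] := lp [seq r z | z <- s] (e / 2) (maxn M N) (ltac:(lra)).
move: Mn; rewrite geq_max => /andP[Mn Nn].
exists n; split => //; rewrite (splitr e); apply: close_on_trans (sM n Mn).
move=> z zs; apply: le_lt_trans (on_slice_dist _ _ _) _.
exact/sn/map_f.
Qed.

Lemma transfer_closure p : K p -> closure (range v) (transfer p).
Proof.
move=> /closure_cases[lp|[n <- nl]].
  by rewrite transfer_limit //; apply: cluster_on_closure; exact: on_slice_limit.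
by rewrite transfer_isolated //; apply: subset_closure; exists n.
Qed.

Lemma transfer_inj : {in K &, injective transfer}.
Proof.
move=> p q /set_mem Kp /set_mem Kq.
have [lp|[n <- nl]] := closure_cases Kp; have [lq|[m <- ml]] := closure_cases Kq.
- by rewrite !transfer_limit //; exact: on_slice_inj.
- by rewrite transfer_limit // transfer_isolated // => /esym/v_neq.
- by rewrite transfer_isolated // transfer_limit // => /v_neq.
- by rewrite !transfer_isolated // => /v_inj ->.
Qed.

(** Let [p] be a limit point. Limit points near [p] stay near because [on_slice] shrinks distances.
    A nearby [u m] that is not a limit point has large [m], by [finite_separation], so [v m] is
    close to the copy of [u m]. All other points are isolated in [K]. *)
Lemma transfer_continuous : {within K, continuous transfer}.
Proof.
apply/subspace_continuousP => p Kp P /ptws_nbhsP[s [e [e0 sP]]].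
suff [t [d [d0 tP]]] : exists t d, 0 < d /\ forall q, K q -> close_on t d p q ->
    close_on s e (transfer p) (transfer q).
  by apply/ptws_nbhsP; exists t, d; split => // q tq Kq; apply: sP; exact: tP.
have [lp|[n np nl]] := closure_cases Kp; last first.
  have [t [d [d0 tP]]] : exists t d, 0 < d /\ forall q, K q -> close_on t d p q -> q = p.
    by apply: isolated_in_closure; rewrite -np.
  by exists t, d; split => // q Kq /(tP q Kq) -> z _; rewrite subrr normr0.
have [N sN] := uniform_v_asymp s (e := e / 2) (ltac:(lra)).
have [t [d [d0 tN]]] := finite_separation u p N.
exists ([seq r z | z <- s] ++ t), (Num.min (e / 2) d); split.
  by rewrite lt_min d0 divr_gt0.
move=> q Kq /close_onI[sq tq]; rewrite transfer_limit //.
have {}sq : close_on s (e / 2) (on_slice p) (on_slice q).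
  move=> z zs; apply: le_lt_trans (on_slice_dist _ _ _) _.
  exact/sq/map_f.
have [lq|[m mq ml]] := closure_cases Kq.
  by rewrite transfer_limit //; apply: close_onW sq => //; lra.
rewrite -mq transfer_isolated // (splitr e); apply: (close_on_trans sq).
rewrite -mq; apply: sN; rewrite leqNgt; apply/negP => /tN; rewrite mq => /(_ tq) qp.
by apply: ml; rewrite mq qp.
Qed.

Lemma closure_bounded p : K p -> forall x, `|p x| <= 1.
Proof.
move=> /closure_closeP up x; apply/ler_addgt0Pr => e e0.
have [_ [n _ <-] /(_ x)] := up [:: x] e e0; rewrite mem_seq1 eqxx => /(_ isT) un.
have := u_bounded n x.
have := lerB_dist (p x) (u n x); rewrite distrC; lra.
Qed.

Lemma closure_compact : compact K.
Proof.
have box : compact [set p : {ptws X -> R} | forall x, `[-1, 1]%classic (p x)].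
  exact: (@tychonoff X (fun=> R) (fun=> `[-1, 1]%classic) (fun=> @segment_compact _ _ _)).
apply: (subclosed_compact _ box); first exact: closed_closure.
by move=> p Kp x; rewrite /= in_itv /= -ler_norml; exact: closure_bounded.
Qed.

Lemma closure_embedding (B : set {ptws Z -> R}) : closure (range v) `<=` B ->
  exists h : set_type K -> set_type B, homeomorphic_embedding h.
Proof.
move=> vB; apply: (compact_homeomorphic_embedding closure_compact _
  transfer_continuous _ transfer_inj).
  exact: (@hausdorff_product Z (fun=> R) (fun=> @norm_hausdorff _ _)).
by move=> p /transfer_closure /vB.
Qed.

End Embedding.

(** * The tree inside the Cantor set, and the amalgam of a family on it *)

Lemma suffix_comparable (T : eqType) (s1 s2 s3 : seq T) :
  suffix s1 s3 -> suffix s2 s3 -> (size s1 <= size s2)%N -> suffix s1 s2.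
Proof.
rewrite -!(prefix_rev _ s3) -(prefix_rev s1 s2) !prefixE !size_rev.
by move=> /eqP <- /eqP <- le; rewrite take_takel ?size_rev// -{2}(size_rev s1).
Qed.

(* A natural number stands for the finite sequence it codes, listed with the
   most recent label first, so that the ancestors of a node are its suffixes. *)
Definition anc (i j : nat) : bool :=
  suffix (CodeSeq.decode i) (CodeSeq.decode j).

Lemma anc_refl j : anc j j. Proof. exact: suffix_refl. Qed.

Lemma anc_trans : transitive anc. Proof. by move=> j i k; exact: suffix_trans. Qed.

Lemma anc_leq i j : anc i j -> (i <= j)%N.
Proof.
rewrite -{2}(CodeSeq.decodeK i) -{2}(CodeSeq.decodeK j) => /suffixP[s ->].
elim: s => //= n s IHs; apply: (leq_trans IHs); set c := CodeSeq.code _.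
(* Prepending a label [n] to a sequence of code [c] gives the code [2 ^ n * c.*2.+1]. *)
rewrite (@leq_trans c.*2.+1)//; first by rewrite -addnn -addnS leq_addr.
by rewrite leq_pmull// expn_gt0.
Qed.

Lemma anc_between i j k : anc j k -> (i <= j)%N -> anc i k = anc i j.
Proof.
move=> jk ij; apply/idP/idP => [ik|/anc_trans]; last exact.
have [le|/ltnW le] := leqP (size (CodeSeq.decode i)) (size (CodeSeq.decode j)).
  exact: suffix_comparable ik jk le.
have ji : anc j i by exact: suffix_comparable jk ik le.
have /eqP -> : i == j by rewrite eqn_leq ij anc_leq.
exact: anc_refl.
Qed.

(* The Cantor set as the set of subsets of the tree: since ancestors have smaller
   codes, the nodes that a given [sigma] runs through form a chain. *)
Definition thru (j : nat) (sigma : cantor_space) : bool :=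
  [forall i : 'I_j.+1, sigma i == anc i j].

Lemma thruP j (sigma : cantor_space) :
  reflect (forall i, (i <= j)%N -> sigma i = anc i j) (thru j sigma).
Proof.
apply: (iffP forallP) => [t i ij|t i]; last by apply/eqP/t; rewrite -ltnS.
by apply/eqP; exact: (t (Ordinal (ij : (i < j.+1)%N))).
Qed.

Lemma thru_anc j k sigma : anc j k -> thru k sigma -> thru j sigma.
Proof.
move=> jk /thruP tk; apply/thruP => i ij.
by rewrite tk ?(anc_between jk)// (leq_trans ij) ?anc_leq.
Qed.

Lemma thru_leq_anc j k sigma : thru j sigma -> thru k sigma -> (j <= k)%N -> anc j k.
Proof. by move=> /thruP tj /thruP tk jk; rewrite -tk// tj// anc_refl. Qed.

(** The finite branch ending at [j], as a point of the Cantor set. *)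
Definition node (j : nat) : cantor_space := anc^~ j.

Lemma thru_node i j : thru i (node j) = anc i j.
Proof.
apply/thruP/idP => [/(_ i (leqnn i))|ij k ki]; first by rewrite /node anc_refl.
exact: anc_between.
Qed.

Lemma thru_inj j k : thru j =1 thru k -> j = k.
Proof.
move=> jk; have akj : anc k j by rewrite -thru_node -jk thru_node anc_refl.
have ajk : anc j k by rewrite -thru_node jk thru_node anc_refl.
by apply/eqP; rewrite eqn_leq !anc_leq.
Qed.

(** The Cantor set is its own square: [z] stands for the pair of an argument [even_bits z] and a
    branch [odd_bits z]. *)
Definition even_bits (z : cantor_space) : cantor_space := fun n => z n.*2.
Definition odd_bits (z : cantor_space) : cantor_space := fun n => z n.*2.+1.
Definition interleave (x sigma : cantor_space) : cantor_space :=
  fun n => if odd n then sigma n./2 else x n./2.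

Lemma even_bits_interleave x sigma : even_bits (interleave x sigma) = x.
Proof. by apply/funext => n; rewrite /even_bits /interleave odd_double doubleK. Qed.

Lemma odd_bits_interleave x sigma : odd_bits (interleave x sigma) = sigma.
Proof.
by apply/funext => n; rewrite /odd_bits /interleave /= odd_double /= uphalf_double.
Qed.

Lemma even_odd_bits z z' :
  even_bits z = even_bits z' -> odd_bits z = odd_bits z' -> z = z'.
Proof.
move=> ez oz; apply/funext => n; rewrite -(odd_double_half n); case: (odd n).
  exact: (congr1 (fun f => f n./2) oz).
exact: (congr1 (fun f => f n./2) ez).
Qed.

Lemma near_bit (z : cantor_space) i : \forall z' \near z, z' i = z i.
Proof.
have zi : nbhs (z i) [set z i] by exact: discrete_set1.
exact: (@proj_continuous nat (fun=> bool) i z _ zi).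
Qed.

Lemma near_bits (z : cantor_space) k :
  \forall z' \near z, forall i, (i < k)%N -> z' i = z i.
Proof.
elim: k => [|k IHk]; first by apply: filterS filterT.
apply: filterS2 IHk (near_bit z k) => z' zk z'k i.
by rewrite ltnS leq_eqVlt => /orP[/eqP->//|]; exact: zk.
Qed.

Lemma even_bits_continuous : continuous even_bits.
Proof.
move=> z; apply/(@pointwise_cvgP nat bool) => n A /= An.
apply: filterS (near_bit z n.*2) => z' /= z'n.
by rewrite /even_bits z'n; exact: nbhs_singleton.
Qed.

Section Amalgam.
Context {R : realType}.
Implicit Types (p : cantor_space -> R).

Lemma continuous_if p (c : cantor_space -> bool) k :
  (forall z z', (forall i, (i < k)%N -> z' i = z i) -> c z' = c z) ->
  continuous p -> continuous (fun z => if c z then p (even_bits z) else 0).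
Proof.
move=> ck cp z.
have pe : continuous (p \o even_bits).
  by move=> x; apply: continuous_comp; [exact: even_bits_continuous|exact: cp].
case cz : (c z).
  rewrite /continuous_at cz; apply: cvg_trans (pe z); apply: near_eq_cvg.
  have := near_bits z k; apply: filterS => z' /(ck z) /=; rewrite cz => ->.
  by [].
rewrite /continuous_at cz; apply: cvg_near_cst.
by have := near_bits z k; apply: filterS => z' /(ck z) /=; rewrite cz => ->.
Qed.

Variable H : nat -> cantor_space -> R.
Hypothesis H_continuous : forall j, continuous (H j).
Hypothesis H_bounded : forall j x, `|H j x| <= 1.
Hypothesis H_neq0 : forall j, exists x, H j x != 0.
Hypothesis H_baire1 : forall sigma p,
  cluster_on [set j | thru j sigma] H p -> baire1 p.

Definition amalgam (j : nat) : cantor_space -> R :=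
  fun z => if thru j (odd_bits z) then H j (even_bits z) else 0.

Lemma amalgam_interleave j x sigma :
  amalgam j (interleave x sigma) = if thru j sigma then H j x else 0.
Proof. by rewrite /amalgam even_bits_interleave odd_bits_interleave. Qed.

Lemma amalgam_continuous j : continuous (amalgam j).
Proof.
apply: (@continuous_if (H j) (fun z => thru j (odd_bits z)) j.*2.+2) => // z z' zz'.
by apply: eq_forallb => i; rewrite /odd_bits zz' // !ltnS leq_double -ltnS.
Qed.

Lemma amalgam_bounded j z : `|amalgam j z| <= 1.
Proof. by rewrite /amalgam; case: ifP => // _; rewrite normr0 ler01. Qed.

Lemma amalgam_inj : injective amalgam.
Proof.
have aux j sigma : thru j sigma = `[< exists x, amalgam j (interleave x sigma) != 0 >].
  apply/idP/asboolP => [tj|[x]].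
    by have [x Hx] := H_neq0 j; exists x; rewrite amalgam_interleave tj.
  by rewrite amalgam_interleave; case: ifP => //; rewrite eqxx.
by move=> j k jk; apply: thru_inj => sigma; rewrite !aux jk.
Qed.

(** The indicator of the slice is the pointwise limit of indicators of clopen sets, where the first
    [n] odd bits agree with [sigma]. *)
Lemma baire1_slice p sigma : baire1 p ->
  baire1 (on_slice (fun z => odd_bits z = sigma) even_bits p).
Proof.
move=> [u cu up].
exists (fun n z => if [forall i : 'I_n, odd_bits z i == sigma i]
                   then u n (even_bits z) else 0).
  move=> n; apply: (@continuous_if _ _ n.*2) => // z z' zz'.
  by apply: eq_forallb => i; rewrite /odd_bits zz' // ltn_Sdouble.
move=> z; rewrite /on_slice; case: asboolP => [zs|zs].
  apply: cvg_trans (up (even_bits z)); apply: near_eq_cvg; apply: nearW => n.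
  by rewrite (_ : [forall i : 'I_n, _] = true)//; apply/forallP => i; rewrite zs.
have [i zi] : exists i, odd_bits z i != sigma i.
  apply: contrapT => /forallNP zs'; apply: zs; apply/funext => i.
  by apply/eqP/negPn/negP/zs'.
apply: cvg_near_cst; exists i.+1 => // n /= ni; case: forallP => // /(_ (Ordinal ni)) /=.
by rewrite (negPf zi).
Qed.

Lemma amalgam_baire1 (p : {ptws cantor_space -> R}) :
  closure (range amalgam : set {ptws cantor_space -> R}) p -> baire1 p.
Proof.
move=> /closure_seq[[n _ <-]|cp].
  by exists (fun=> amalgam n) => [_|x]; [exact: amalgam_continuous|exact: cvg_cst].
have [p0|/existsNP[z0 /eqP p0]] := pselect (forall z, p z = 0).
  exists (fun _ _ => 0) => [_|x]; first exact: cst_continuous.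
  by rewrite p0; exact: cvg_cst.
set sigma := odd_bits z0.
(* A term within [|p z0|] of [p] at [z0] does not vanish there, so its node lies on [sigma]. *)
have thruN (t : seq cantor_space) (e : R) N : 0 < e -> exists n,
    [/\ thru n sigma, (N <= n)%N & close_on t e p (amalgam n)].
  move=> e0; have [|n [_ Nn /close_onI[tn zn]]] :=
    cp (t ++ [:: z0]) (Num.min e `|p z0|) N.
    by rewrite lt_min e0 normr_gt0.
  exists n; split => //; have := zn z0; rewrite mem_seq1 eqxx => /(_ isT).
  by rewrite /amalgam; case: ifP => //; rewrite sub0r normrN ltxx.
have pE : p = on_slice (fun z => odd_bits z = sigma) even_bits
    (fun x => p (interleave x sigma)).
  apply/funext => z; rewrite /on_slice; case: asboolP => [zs|zs].
    by congr (p _); apply: even_odd_bits;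
      rewrite ?even_bits_interleave ?odd_bits_interleave.
  (* A node [n >= i] on [sigma] is not met by [odd_bits z], which leaves [sigma] at bit [i]; hence
     [amalgam n z] is zero for all such [n]. *)
  have [i zi] : exists i, odd_bits z i != sigma i.
    apply: contrapT => /forallNP zs'; apply: zs; apply/funext => i.
    by apply/eqP/negPn/negP/zs'.
  apply/eqP; rewrite -normr_le0; apply/ler_addgt0Pr => e e0; rewrite add0r.
  have [n [tn ni /(_ z)]] := thruN [:: z] e i e0; rewrite mem_seq1 eqxx => /(_ isT).
  rewrite /amalgam ifF; first by rewrite sub0r normrN => /ltW.
  apply/negP => /thruP/(_ i ni) zi'; move: tn => /thruP/(_ i ni) si.
  by rewrite zi' si eqxx in zi.
rewrite pE; apply: baire1_slice; apply: (H_baire1 (sigma := sigma)).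
move=> t e N e0.
have [n [tn Nn sn]] := thruN [seq interleave x sigma | x <- t] e N e0.
exists n; split => // x xt; have := sn _ (map_f _ xt).
by rewrite amalgam_interleave tn.
Qed.

End Amalgam.

(** * Branches of the amalgam *)

Section Supnorm.
Context {R : realType} {X : Type}.
Implicit Types f : X -> R.

Lemma supnorm_le f M (x0 : X) : (forall x, `|f x| <= M) -> supnorm f <= M.
Proof.
move=> fM; apply: ge_sup; first by exists `|f x0|, x0.
by move=> _ [x _ <-].
Qed.

Lemma le_supnorm f M x : (forall x, `|f x| <= M) -> `|f x| <= supnorm f.
Proof.
move=> fM; apply: ub_le_sup; last by exists x.
by exists M => _ [y _ <-].
Qed.

End Supnorm.

Section Branch.
Context {R : realType}.
Variable H : nat -> cantor_space -> R.
Hypothesis H_neq0 : forall j, exists x, H j x != 0.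
Hypothesis H_bounded : forall j x, `|H j x| <= 1.
Variable l : nat -> nat.
Hypothesis l_incr : {homo l : m n / (m < n)%N}.
Hypothesis l_anc : forall n, anc (l n) (l n.+1).

Lemma branch_anc m n : (m <= n)%N -> anc (l m) (l n).
Proof.
elim: n => [|n IHn]; first by rewrite leqn0 => /eqP ->; exact: anc_refl.
rewrite leq_eqVlt => /orP[/eqP->|/IHn mn]; first exact: anc_refl.
exact: anc_trans mn (l_anc n).
Qed.

(** All ancestors are included, since [l] may skip nodes. *)
Definition branch_end : cantor_space := fun i => `[< exists n, anc i (l n) >].

Lemma branch_endE n i : (i <= l n)%N -> branch_end i = anc i (l n).
Proof.
move=> iln; apply/asboolP/idP => [[m im]|il]; last by exists n.
have [mn|/ltnW nm] := leqP m n; first exact: anc_trans im (branch_anc mn).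
by rewrite -(anc_between (branch_anc nm)).
Qed.

Lemma leq_branch n : (n <= l n)%N.
Proof. by elim: n => // n IHn; apply: leq_ltn_trans IHn (l_incr _). Qed.

Lemma thru_branch_end n : thru (l n) branch_end.
Proof. by apply/thruP => i; exact: branch_endE. Qed.

(** [amalgam H (l n)] is nonzero somewhere over the finite branch [node (l n)], which differs from
    [branch_end] at bit [l n.+1]. *)
Lemma branch_slice_neq n p :
  amalgam H (l n) <> on_slice (fun z => odd_bits z = branch_end) even_bits p.
Proof.
have [x Hx] := H_neq0 (l n); move=> /(congr1 (@^~ (interleave x (node (l n))))).
rewrite amalgam_interleave thru_node anc_refl /on_slice asboolF.
  by move=> Hx0; rewrite Hx0 eqxx in Hx.
rewrite odd_bits_interleave => /(congr1 (@^~ (l n.+1))).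
rewrite (branch_endE (leqnn _)) anc_refl => /anc_leq.
by rewrite leqNgt l_incr.
Qed.

Lemma branch_asymp (u : nat -> cantor_space -> R) (c : nat -> R) :
  (forall n x, `|H (l n) x - u n x| <= c n) ->
  (forall e, 0 < e -> exists N, forall n, (N <= n)%N -> c n < e) ->
  forall z (e : R), 0 < e -> exists N, forall n, (N <= n)%N ->
  `|amalgam H (l n) z
    - on_slice (fun z => odd_bits z = branch_end) even_bits (u n) z| < e.
Proof.
move=> Hu c0 z e e0; rewrite /on_slice; case: asboolP => [zs|zs].
  have [N cN] := c0 e e0; exists N => n /cN; apply: le_lt_trans.
  by rewrite /amalgam zs thru_branch_end.
have [i zi] : exists i, odd_bits z i != branch_end i.
  apply: contrapT => /forallNP zs'; apply: zs; apply/funext => i.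
  by apply/eqP/negPn/negP/zs'.
exists i => n ni; rewrite subr0 /amalgam ifF ?normr0//.
have il : (i <= l n)%N := leq_trans ni (leq_branch n).
by apply: contraNF zi => /thruP/(_ i il) ->; rewrite (branch_endE il).
Qed.

(** Meeting a node entails meeting its ancestors, so the [l n] met by [odd_bits z] form an initial
    segment. *)
Lemma branch_partial_sum (a : nat -> R) k z : exists2 i, (i <= k)%N &
  \sum_(n < k) a n * amalgam H (l n) z = \sum_(n < i) a n * H (l n) (even_bits z).
Proof.
elim: k => [|k [i ik IHk]]; first by exists 0%N; rewrite // !big_ord0.
have [zk|zk] := boolP (thru (l k) (odd_bits z)).
  exists k.+1 => //; apply: eq_bigr => n _; congr (_ * _).
  by rewrite /amalgam (thru_anc (branch_anc (ltn_ord n : (n <= k)%N)) zk).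
exists i; first exact: leqW.
by rewrite big_ord_recr /= IHk /amalgam (negPf zk) mulr0 addr0.
Qed.

Lemma branch_sum_node (a : nat -> R) k i x : (i < k)%N ->
  \sum_(n < k) a n * amalgam H (l n) (interleave x (node (l i)))
  = \sum_(n < i.+1) a n * H (l n) x.
Proof.
move=> ik; rewrite -(subnKC ik) big_split_ord /= [X in _ + X]big1 ?addr0.
  apply: eq_bigr => n _; rewrite amalgam_interleave thru_node branch_anc//.
  by rewrite -ltnS.
move=> n _; rewrite amalgam_interleave thru_node ifF ?mulr0//.
by apply/negP => /anc_leq; rewrite leqNgt l_incr // addSn ltnS leq_addr.
Qed.

(** The two preceding lemmas match values of the amalgamated sum with values of partial sums of the
    [H (l n)]; replacing these by the [u n] costs at most [E]. *)
Lemma branch_norm (u : nat -> cantor_space -> R) (eps : R) :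
  0 < eps -> (forall n x, `|u n x| <= 1) ->
  (forall n x, `|H (l n) x - u n x| <= eps / 2 ^+ n.+1) ->
  forall (k : nat) (a : nat -> R),
  `| \big[Num.max/0]_(i < k.+1) supnorm (fun y => \sum_(n < i.+1) a n * u n y)
     - supnorm (fun x => \sum_(n < k.+1) a n * amalgam H (l n) x) |
  <= eps * \sum_(n < k.+1) `|a n| / 2 ^+ n.+1.
Proof.
move=> eps0 u1 Hu k a; set E := eps * _.
have sum_mono (F : nat -> R) i : (forall n, 0 <= F n) -> (i <= k.+1)%N ->
    \sum_(n < i) F n <= \sum_(n < k.+1) F n.
  move=> F0 ik; rewrite -(subnKC ik) big_split_ord /= lerDl.
  by apply: sumr_ge0 => n _; exact: F0.
have sum_bound (v : nat -> R) i : (forall n, `|v n| <= 1) -> (i <= k.+1)%N ->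
    `|\sum_(n < i) a n * v n| <= \sum_(n < k.+1) `|a n|.
  move=> v1 ik; apply: le_trans (sum_mono (fun n => `|a n|) i _ ik) => //.
  apply: le_trans (ler_norm_sum _ _ _) _; apply: ler_sum => n _.
  by rewrite normrM ler_piMr.
have sum_close i x : (i <= k.+1)%N ->
    `|\sum_(n < i) a n * H (l n) x - \sum_(n < i) a n * u n x| <= E.
  move=> ik; rewrite -sumrB /E mulr_sumr.
  apply: le_trans (sum_mono (fun n => eps * (`|a n| / 2 ^+ n.+1)) i _ ik).
    apply: le_trans (ler_norm_sum _ _ _) _; apply: ler_sum => n _.
    by rewrite -mulrBr normrM mulrCA ler_wpM2l.
  by move=> n; rewrite mulr_ge0 ?divr_ge0 ?exprn_ge0 ?(ltW eps0).
have E0 : 0 <= E by apply: le_trans (sum_close 0%N (node 0) _).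
set M := \big[_/_]_(i < _) _; set N := supnorm _.
(* The empty sum is included because a point may meet no [l n] at all; the seed of the maximum
   bounds it. *)
have uM i x : (i <= k.+1)%N -> `|\sum_(n < i) a n * u n x| <= M.
  case: i => [_|i ik]; first by rewrite big_ord0 normr0; exact: bigmax_ge_id.
  apply: le_trans (le_bigmax _ _ (Ordinal ik)) => /=.
  by apply: (@le_supnorm _ _ _ (\sum_(n < k.+1) `|a n|)) => y; exact: (sum_bound (u^~ y)).
have fN z : `|\sum_(n < k.+1) a n * amalgam H (l n) z| <= N.
  apply: (@le_supnorm _ _ _ (\sum_(n < k.+1) `|a n|)) => y.
  apply: (sum_bound (fun n => amalgam H (l n) y)) => // n; exact: amalgam_bounded.
have NM : N <= M + E.
  apply: (supnorm_le (node 0)) => z.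
  have [i ik ->] := branch_partial_sum a k.+1 z.
  have := sum_close i (even_bits z) ik; have := uM i (even_bits z) ik.
  set s := \sum_(_ < _) _; set t := \sum_(_ < _) _ => tM st.
  by have := ler_normD (t - s) s; rewrite subrK; lra.
have MN : M <= N + E.
  apply: bigmax_le => [|i _]; first by rewrite addr_ge0 // (le_trans _ (fN (node 0))).
  apply: (supnorm_le (node 0)) => x.
  have := fN (interleave x (node (l i))); rewrite branch_sum_node//.
  have := sum_close i.+1 x (ltn_ord i).
  set s := \sum_(_ < _) _; set t := \sum_(_ < _) _; rewrite distrC => st sN.
  by have := ler_normD (t - s) s; rewrite subrK; lra.
by rewrite ler_norml; apply/andP; split; lra.
Qed.

End Branch.

Lemma geometric_vanish (R : realType) (e : R) : 0 < e ->
  exists N, forall n, (N <= n)%N -> (2 ^+ n)^-1 < e.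
Proof.
move=> e0; have [N _ eN] : \forall n \near \oo, (2^-1 : R) ^+ n < e.
  have : (2^-1 : R) ^+ n @[n --> \oo] --> 0.
    by apply: cvg_expr; rewrite gtr0_norm ?invf_lt1 ?ltr1n.
  move=> /cvgrPdist_lt/(_ e e0); apply: filterS => n.
  by rewrite sub0r normrN ger0_norm ?exprn_ge0 ?invr_ge0.
by exists N => n Nn; rewrite -exprVn; exact: eN.
Qed.

Lemma mem_unit_ball (R : realType) (X : topologicalType) (f : X -> R) :
  continuous f -> (forall x, `|f x| <= 1) ->
  (f : {uniform X -> R}) \in @unit_ball R X.
Proof. by move=> cf f1; apply: mem_set; split. Qed.

Definition to_ball_seq (R : realType) (X : topologicalType) (f : nat -> X -> R)
    (cf : forall n, continuous (f n)) (f1 : forall n x, `|f n x| <= 1) : ball_seq R X :=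
  fun n => exist _ (f n : {uniform X -> R}) (mem_unit_ball (cf n) (f1 n)).

Lemma to_ball_seqE (R : realType) (X : topologicalType) (f : nat -> X -> R)
    (cf : forall n, continuous (f n)) (f1 : forall n x, `|f n x| <= 1) :
  seq_fun (to_ball_seq cf f1) = f.
Proof. by []. Qed.

Lemma seq_fun_continuous (R : realType) (X : topologicalType) (f : ball_seq R X) n :
  continuous (seq_fun f n).
Proof. by have [] := set_valP (f n). Qed.

Lemma seq_fun_bounded (R : realType) (X : topologicalType) (f : ball_seq R X) n x :
  `|seq_fun f n x| <= 1.
Proof. by have [_] := set_valP (f n); exact. Qed.

(** This reduces the theorem to a choice of [H]. The branch of accuracy 1 already embeds the
    closures, since its errors tend to zero; the branch of accuracy [eps] gives the norm
    estimate. *)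
Lemma amalgam_universal (R : realType) (H : nat -> cantor_space -> R) :
  (forall j, continuous (H j)) -> (forall j x, `|H j x| <= 1) ->
  (forall j, exists x, H j x != 0) ->
  (forall sigma p, cluster_on [set j | thru j sigma] H p -> baire1 p) ->
  exists2 f : ball_seq R cantor_space, SRC f &
  forall g : ball_seq R cantor_space, SRC g ->
  (forall eps : R, 0 < eps -> exists l : nat -> nat,
    [/\ {homo l : m n / (m < n)%N}, forall n, anc (l n) (l n.+1) &
     forall n x, `|H (l n) x - seq_fun g n x| <= eps / 2 ^+ n.+1]) ->
  strongly_embeds g f.
Proof.
move=> cH H1 H0 HB; exists (to_ball_seq (amalgam_continuous cH) (amalgam_bounded H1)).
  split; first exact: amalgam_baire1.
  exact: amalgam_inj.
move=> g [_ g_inj] gl; split.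
  have [l [l_incr l_anc lg]] := gl 1 ltr01.
  apply: (@closure_embedding R cantor_space cantor_space (seq_fun g)
    (fun n => amalgam H (l n)) (fun z => odd_bits z = branch_end l) even_bits).
  - by move=> x; exists (interleave x (branch_end l));
      rewrite ?odd_bits_interleave ?even_bits_interleave.
  - exact: seq_fun_bounded.
  - exact: g_inj.
  - move=> m n /(amalgam_inj H0) lmn.
    case: (ltngtP m n) => // /l_incr; by rewrite lmn ltnn.
  - exact: branch_slice_neq.
  - apply: (branch_asymp l_incr l_anc lg) => e /geometric_vanish[N eN].
    by exists N => n Nn; rewrite mul1r eN // leqW.
  - by apply: closure_subset => _ [n _ <-]; exists (l n).
move=> eps eps0; have [l [l_incr l_anc lg]] := gl eps eps0.
exists l => // k a.
exact: (branch_norm H1 l_incr l_anc eps0 (@seq_fun_bounded _ _ g) lg).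
Qed.

(** * Coding the analytic set *)

Lemma cluster_vanish (R : realType) (X : topologicalType) (S : set nat)
    (u : nat -> {ptws X -> R}) (p : {ptws X -> R}) :
  cluster_on S u p ->
  (forall x (e : R), 0 < e -> exists N, forall n, S n -> (N <= n)%N -> `|u n x| < e) ->
  p = (fun=> 0).
Proof.
move=> Sp u0; apply/funext => x; apply/eqP; rewrite -normr_le0.
apply/ler_addgt0Pr => e e0; rewrite add0r.
have [N uN] := u0 x (e / 2) (ltac:(lra)).
have [n [Sn Nn /(_ x)]] := Sp [:: x] (e / 2) N (ltac:(lra)).
rewrite mem_seq1 eqxx => /(_ isT); have := uN n Sn Nn.
by have := lerB_dist (p x) (u n x); rewrite distrC; lra.
Qed.

Lemma baire1_continuous (R : realType) (X : topologicalType) (f : X -> R) :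
  continuous f -> baire1 f.
Proof. by move=> cf; exists (fun=> f) => // x; exact: cvg_cst. Qed.

(** This serves the case of an empty analytic set: distinct constants tending to zero. *)
Lemma SRC_nonempty (R : realType) : exists f : ball_seq R cantor_space, SRC f.
Proof.
pose c (n : nat) (_ : cantor_space) : R := (2 ^+ n)^-1.
have cc n : continuous (c n) by exact: cst_continuous.
have c1 n x : `|c n x| <= 1.
  by rewrite /c ger0_norm ?invr_ge0 ?exprn_ge0// invf_le1 ?exprn_gt0// exprn_ege1 ?ler1n.
exists (to_ball_seq cc c1); split.
  move=> p /closure_seq[[n _ <-]|/cluster_vanish ->].
  - exact: baire1_continuous.
  - exact/baire1_continuous/cst_continuous.
  - move=> x e /geometric_vanish[N eN]; exists N => n _ /eN.
    by rewrite to_ball_seqE /c ger0_norm ?invr_ge0 ?exprn_ge0.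
move=> m n /(congr1 (@^~ (node 0))) /invr_inj.
by rewrite -!natrX => /eqP; rewrite eqr_nat eqn_exp2l// => /eqP.
Qed.

Lemma near_seq_fun (R : realType) (Y X : topologicalType) (h : Y -> ball_seq R X)
    (n : nat) (y : Y) (e : R) : continuous h -> 0 < e ->
  \forall y' \near y, forall x, `|seq_fun (h y') n x - seq_fun (h y) n x| < e.
Proof.
move=> ch e0.
have ballf : nbhs (set_val (h y n)) [set f : {uniform X -> R} |
    forall x, `|f x - seq_fun (h y) n x| < e].
  apply/uniform_nbhs; exists [set ab | `|ab.2 - ab.1| < e]; split.
    rewrite -entourage_ballE; exists e => //= -[a b] /=.
    by rewrite -ball_normE /= distrC.
  by move=> f /= fe x; exact: fe.
have cval := @initial_continuous _ _ (@set_val _ (@unit_ball R X)) (h y n) _ ballf.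
have cproj := @proj_continuous nat (fun=> set_type (@unit_ball R X)) n (h y) _ cval.
exact: (ch y _ cproj).
Qed.

Lemma inv_exp2_le (R : realType) i j : (i <= j)%N -> (2 ^+ j)^-1 <= (2 ^+ i)^-1 :> R.
Proof. by move=> ij; rewrite lef_pV2 ?posrE ?exprn_gt0// ler_weXn2l ?ler1n. Qed.

Lemma inv_exp2_split (R : realType) i :
  (2 ^+ i)^-1 = (2 ^+ i.+1)^-1 + (2 ^+ i.+1)^-1 :> R.
Proof. by rewrite [in RHS]exprS invfM; lra. Qed.

Definition depth (j : nat) : nat := size (CodeSeq.decode j).

Lemma anc_depth i j : anc i j -> (i < j)%N -> (depth i < depth j)%N.
Proof.
move=> ij lt_ij; rewrite ltn_neqAle size_suffix ?andbT//.
apply/eqP => eij; move: ij lt_ij; rewrite /anc suffixE -/(depth i) -/(depth j) eij.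
by rewrite subnn drop0 => /eqP/(can_inj CodeSeq.decodeK) ->; rewrite ltnn.
Qed.

(** The nodes on [sigma] form a chain along which depth strictly grows with the code. *)
Lemma thru_depth (sigma : cantor_space) :
  (forall N, exists2 j, thru j sigma & (N <= j)%N) ->
  forall n, exists N, forall j, thru j sigma -> (N <= j)%N -> (n <= depth j)%N.
Proof.
move=> unb; elim=> [|n [N nN]]; first by exists 0%N.
have [i ti Ni] := unb N; exists i.+1 => j tj ij.
apply: leq_trans (anc_depth (thru_leq_anc ti tj (ltnW ij)) ij).
by rewrite ltnS nN.
Qed.

Section Coding.
Context {R : realType} {Y : metricType R}.
Variable h : Y -> ball_seq R cantor_space.
Variable d : nat -> Y.
Hypothesis Y_complete : complete_metric Y.
Hypothesis h_continuous : continuous h.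
Hypothesis h_SRC : forall y, SRC (h y).
Hypothesis d_dense : dense (range d).

Definition label (j : nat) : Y := d (head 0%N (CodeSeq.decode j)).

(* The first label chosen on a branch fixes the accuracy of the whole branch,
   so that the labels of points of [Y] start at depth 2. *)
Definition tolerance (j : nat) : R :=
  (2 ^+ (last 0%N (CodeSeq.decode j) + depth j))^-1.

(** A node of depth [n.+2] carries term [n], whence the [.-2]. The first half makes the labels along
    a branch Cauchy; the second passes to the limit of the labels. *)
Definition coherent (i j : nat) : Prop :=
  ball (label i) ((2 ^+ depth i)^-1) (label j) /\
  forall x, `|seq_fun (h (label i)) (depth i).-2 x
             - seq_fun (h (label j)) (depth i).-2 x| <= tolerance i.

(* All pairs below [k], not only those ending in [k], so that goodness passes
   to ancestors. *)
Definition good (k : nat) : Prop :=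
  forall i j, anc i j -> anc j k -> (1 < depth i)%N -> coherent i j.

Lemma good_anc j k : anc j k -> good k -> good j.
Proof. by move=> jk gk i i' ii' i'j; apply: gk ii' _; exact: anc_trans jk. Qed.

(* Bad nodes and zero functions get small constants: the family must be
   injective, so no entry may vanish. *)
Definition entry (j : nat) (x : cantor_space) : R :=
  if `[< good j /\ exists x, seq_fun (h (label j)) (depth j).-2 x != 0 >]
  then seq_fun (h (label j)) (depth j).-2 x else tolerance j.

Lemma tolerance_gt0 j : 0 < tolerance j.
Proof. by rewrite invr_gt0 exprn_gt0. Qed.

Lemma tolerance_le j n : (n <= depth j)%N -> tolerance j <= (2 ^+ n)^-1.
Proof.
by move=> nj; rewrite inv_exp2_le// (leq_trans nj) ?leq_addl.
Qed.

Lemma entry_continuous j : continuous (entry j).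
Proof.
rewrite /entry; case: asboolP => _; first exact: seq_fun_continuous.
exact: cst_continuous.
Qed.

Lemma entry_bounded j x : `|entry j x| <= 1.
Proof.
rewrite /entry; case: asboolP => _; first exact: seq_fun_bounded.
by rewrite gtr0_norm ?tolerance_gt0// (le_trans (@tolerance_le j 0%N _)) ?expr0 ?invr1.
Qed.

Lemma entry_neq0 j : exists x, entry j x != 0.
Proof.
rewrite /entry; case: asboolP => [[_ [x hx]]|_]; first by exists x.
by exists (node 0); rewrite gt_eqF ?tolerance_gt0.
Qed.

Lemma entry_bad j x : ~ good j -> entry j x = tolerance j.
Proof. by move=> nj; rewrite /entry asboolF // => -[]. Qed.

Lemma entry_good j x : good j ->
  `|entry j x - seq_fun (h (label j)) (depth j).-2 x| <= tolerance j.
Proof.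
move=> gj; rewrite /entry; case: asboolP => [_|nj].
  by rewrite subrr normr0 ltW ?tolerance_gt0.
have -> : seq_fun (h (label j)) (depth j).-2 x = 0.
  by apply/eqP/negPn/negP => hx; apply: nj; split => //; exists x.
by rewrite subr0 gtr0_norm ?tolerance_gt0.
Qed.

Lemma entry_limit_baire1 sigma (p : {ptws cantor_space -> R}) :
  cluster_on [set j | thru j sigma] entry p -> baire1 p.
Proof.
move=> cp.
have unb N : exists2 j, thru j sigma & (N <= j)%N.
  by have [j [tj Nj _]] := cp [::] 1 N ltr01; exists j.
have deep := thru_depth unb.
(* Beyond a bad node every node of [sigma] is bad, so the entries tend to zero and [p] is zero. *)
have [all_good|/existsNP[j0 /not_implyP[tj0 nj0]]] :=
  pselect (forall j, thru j sigma -> good j); last first.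
  rewrite (cluster_vanish cp); first exact/baire1_continuous/cst_continuous.
  move=> x e /geometric_vanish[n en]; have [N nN] := deep n.
  exists (maxn N j0) => j tj; rewrite geq_max => /andP[Nj j0j].
  rewrite entry_bad; last by move=> /(good_anc (thru_leq_anc tj0 tj j0j)).
  rewrite gtr0_norm ?tolerance_gt0//.
  exact: le_lt_trans (tolerance_le (nN j tj Nj)) (en _ _).
(* [F] is the filter of tails of the labels along [sigma]; coherence with one deep node makes it
   Cauchy. *)
pose F : set_system Y :=
  [set P | exists N, forall j, thru j sigma -> (N <= j)%N -> P (label j)].
have FF : ProperFilter F.
  split; first by case=> N F0; have [j tj Nj] := unb N; exact: F0 j tj Nj.
  split; first by exists 0%N.
    move=> P Q [N NP] [M MQ]; exists (maxn N M) => j tj.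
    by rewrite geq_max => /andP[Nj Mj]; split; [exact: NP|exact: MQ].
  by move=> P Q PQ [N NP]; exists N => j tj Nj; exact/PQ/NP.
have [y Fy] : exists y : Y, F --> y.
  apply: Y_complete; apply: (@cauchy_exP _ _ F _) => e e0.
  have [n en] := geometric_vanish e0; have [N nN] := deep (maxn n 2).
  have [i ti Ni] := unb N; exists (label i), i => j tj ij.
  have := nN i ti Ni; rewrite geq_max => /andP[ni i2].
  have [+ _] := all_good j tj i j (thru_leq_anc ti tj ij) (anc_refl j) i2.
  by apply: le_ball; exact/ltW/en.
have limit_close i x : thru i sigma -> (1 < depth i)%N ->
    `|seq_fun (h (label i)) (depth i).-2 x - seq_fun (h y) (depth i).-2 x|
    <= tolerance i.
  move=> ti i2; apply/ler_addgt0Pr => e e0.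
  (* In the coherence of [i] with [j], let [j] go to infinity: the label of [j] tends to [y] and [h]
     is continuous. *)
  have /Fy[N NF] := near_seq_fun (depth i).-2 y h_continuous e0.
  have [j tj] := unb (maxn N i); rewrite geq_max => /andP[Nj ij].
  have [_ /(_ x)] := all_good j tj i j (thru_leq_anc ti tj ij) (anc_refl j) i2.
  have := NF j tj Nj x.
  set a := seq_fun _ _ _; set b := seq_fun _ _ _; set c := seq_fun _ _ _.
  by have := ler_normD (c - a) (a - b); rewrite addrA subrK; lra.
have [+ _] := h_SRC y; apply; apply/closure_closeP => s e e0.
(* A quarter of [e] each for entry against label and for label against [y], and half for [p] against
   the entry. *)
have [n en] := geometric_vanish (e := e / 4) (ltac:(lra)).
have [N nN] := deep (maxn n 2).
have [j [tj Nj sj]] := cp s (e / 2) N (ltac:(lra)).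
have := nN j tj Nj; rewrite geq_max => /andP[nj j2].
exists (seq_fun (h y) (depth j).-2); first by exists (depth j).-2.
move=> x xs; have := sj x xs; have := limit_close j x tj j2.
have := entry_good x (all_good j tj).
have := le_lt_trans (tolerance_le nj) (en n (leqnn n)).
set a := entry j x; set b := seq_fun _ _ _; set c := seq_fun _ _ _ => te ab bc ap.
have := ler_normD (c - b) (b - a); have := ler_normD (c - a) (a - p x).
by rewrite !addrA !subrK (distrC c b) (distrC b a); lra.
Qed.

(** The exponents exceed by one those allowed at depth [n.+2], leaving room for a triangle
    inequality through [y]. All terms up to [n] are controlled, since coherence compares earlier
    terms at later labels. *)
Lemma dense_label y m n : exists k, ball y ((2 ^+ n.+3)^-1) (d k) /\
  forall j x, (j <= n)%N ->
  `|seq_fun (h (d k)) j x - seq_fun (h y) j x| < (2 ^+ (m + n.+3))^-1.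
Proof.
have pos i : 0 < (2 ^+ i)^-1 :> R by rewrite invr_gt0 exprn_gt0.
pose P := [set y' : Y | ball y ((2 ^+ n.+3)^-1) y' /\ forall j x, (j <= n)%N ->
  `|seq_fun (h y') j x - seq_fun (h y) j x| < (2 ^+ (m + n.+3))^-1].
have near_y : nbhs y P.
  apply: filterI; first exact: nbhsx_ballx.
  elim: {1}n => [|n' IHn'].
    have := near_seq_fun 0 y h_continuous (pos (m + n.+3)%N).
    by apply: filterS => y' y'e j x; rewrite leqn0 => /eqP ->.
  have := near_seq_fun n'.+1 y h_continuous (pos (m + n.+3)%N).
  apply: filterS2 IHn' => y' yn' y'e j x; rewrite leq_eqVlt => /orP[/eqP->//|].
  exact: yn'.
have [y' [/interior_subset dP [k _ dk]]] :=
  d_dense (ex_intro _ y near_y) (open_interior P).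
by exists k; rewrite dk.
Qed.

Lemma branch_exists y (eps : R) : 0 < eps -> exists l : nat -> nat,
  [/\ {homo l : m n / (m < n)%N}, forall n, anc (l n) (l n.+1) &
   forall n x, `|entry (l n) x - seq_fun (h y) n x| <= eps / 2 ^+ n.+1].
Proof.
move=> eps0; have [m em] := geometric_vanish eps0.
have [t tP] := choice (dense_label y m).
(* The first label [m] sets the tolerance; the labels after it approximate [y]. *)
pose b := fix b n := if n is n'.+1 then t n' :: b n' else [:: m].
have b_last n : last 0%N (b n) = m.
  by case: n => // n /=; elim: n (t n) => //= n IHn a.
have b_size n : size (b n) = n.+1 by elim: n => //= n ->.
(* Hence the ancestors of [l n] constrained by goodness are themselves nodes [l k]. *)
have b_suffix s n : suffix s (b n) -> (1 < size s)%N ->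
    exists2 k, s = b k.+1 & (k < n)%N.
  elim: n => [/size_suffix/= le|n IHn]; first by rewrite ltnNge le.
  case/suffixP => -[|c s'] /= E; first by exists n.
  have [_ E'] : c = t n /\ s' ++ s = b n by case: E.
  move=> s2; have [k sk kn] : exists2 k, s = b k.+1 & (k < n)%N.
    by apply: IHn s2; rewrite -E'; exact: suffix_suffix.
  by exists k => //; exact: leqW.
pose l n := CodeSeq.code (b n.+1).
have lK n : CodeSeq.decode (l n) = b n.+1 by exact: CodeSeq.codeK.
have l_depth n : depth (l n) = n.+2 by rewrite /depth lK b_size.
have l_label n : label (l n) = d (t n) by rewrite /label lK.
have l_tol n : tolerance (l n) = (2 ^+ (m + n.+2))^-1.
  by rewrite /tolerance lK b_last l_depth.
have l_anc n : anc (l n) (l n.+1) by rewrite /anc !lK; exact: suffix_cons.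
have l_good n : good (l n).
  move=> i j ij jn i2; have j2 := leq_trans i2 (size_suffix ij).
  rewrite /anc lK in jn; have [k' jE k'n] := b_suffix _ _ jn j2.
  move: (ij); rewrite /anc jE => /b_suffix/(_ i2)[k iE kk'].
  have {}iE : i = l k by rewrite /l -iE CodeSeq.decodeK.
  have {}jE : j = l k' by rewrite /l -jE CodeSeq.decodeK.
  rewrite ltnS in kk'; have [[yk hk] [yk' hk']] := (tP k, tP k').
  rewrite iE jE /coherent l_depth !l_label l_tol; split.
    have := ball_triangle (ball_sym yk) yk'; apply: le_ball.
    by rewrite (inv_exp2_split R k.+2) lerD2l inv_exp2_le.
  move=> x /=; have := hk k x (leqnn k); have := hk' k x kk'.
  set p := seq_fun _ _ _; set q := seq_fun _ _ _; set r := seq_fun _ _ _.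
  have := @inv_exp2_le R (m + k.+3)%N (m + k'.+3)%N; rewrite leq_add2l !ltnS => /(_ kk').
  have := ler_normD (r - q) (q - p); rewrite addrA subrK (distrC q p).
  by have := inv_exp2_split R (m + k.+2)%N; rewrite -addnS; lra.
exists l; split => //.
  apply: homo_ltn => [|n]; first exact: ltn_trans.
  rewrite ltn_neqAle anc_leq// andbT; apply/eqP => /(congr1 depth).
  by rewrite !l_depth => /eqP; rewrite eqn_leq ltnn andbF.
move=> n x; have := entry_good x (l_good n); rewrite l_depth l_label l_tol /=.
have := (tP n).2 n x (leqnn n).
set p := entry _ _; set q := seq_fun _ _ _; set r := seq_fun _ _ _ => qr pq.
have := ler_normD (p - q) (q - r); rewrite addrA subrK => pr.
(* The entry is off by at most [2 ^ -(m+n+2)] and the label by less than [2 ^ -(m+n+3)], together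
   below [2 ^ -(m+n+1)], which is at most [eps / 2 ^+ n.+1] by the choice of [m]. *)
have e1 := inv_exp2_split R (m + n.+2)%N; have e2 := inv_exp2_split R (m + n.+1)%N.
rewrite -!addnS in e1 e2.
have e3 : 0 < (2 ^+ (m + n.+3))^-1 :> R by rewrite invr_gt0 exprn_gt0.
have : (2 ^+ (m + n.+1))^-1 <= eps / 2 ^+ n.+1.
  by rewrite exprD invfM ler_wpM2r ?invr_ge0 ?exprn_ge0// ltW// em.
lra.
Qed.

Lemma coding_universal : exists2 f : ball_seq R cantor_space, SRC f &
  forall y, strongly_embeds (h y) f.
Proof.
have [f f_SRC fP] := amalgam_universal entry_continuous entry_bounded entry_neq0
  entry_limit_baire1.
by exists f => // y; apply: fP (h_SRC y) _ => eps; exact: branch_exists.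
Qed.

End Coding.

Lemma dense_sequence (Y : topologicalType) : separable Y -> Y ->
  exists d : nat -> Y, dense (range d).
Proof.
move=> [D Dc Dd] y; have [Dy [_ Dy']] := Dd setT (ex_intro _ y I) openT.
move: Dc => /pfcard_geP[D0|[d]]; first by rewrite D0 in Dy'.
exists d => O O0 oO; have [z [Oz Dz]] := Dd O O0 oO.
by have [n _ dn] := @surj _ _ _ _ d z Dz; exists z; split => //; exists n.
Qed.

Theorem theorem5p1 (R : realType) (A : set (ball_seq R cantor_space))
  (A_SRC : A `<=` @SRC R cantor_space) (A_analytic : analytic R A) :
  exists2 f : ball_seq R cantor_space,
    SRC f & forall g : ball_seq R cantor_space, A g -> strongly_embeds g f.
Proof.
have [Y [h [Y_separable Y_complete h_continuous hA]]] := A_analytic.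
have [[y]|Y_empty] := pselect (inhabited Y); last first.
  have [f f_SRC] := SRC_nonempty R; exists f => // g.
  by rewrite -hA => -[y]; case: Y_empty.
have [d d_dense] := dense_sequence Y_separable y.
have h_SRC y' : SRC (h y') by apply: A_SRC; rewrite -hA; exists y'.
have [f f_SRC fP] := coding_universal Y_complete h_continuous h_SRC d_dense.
by exists f => // g; rewrite -hA => -[y' _ <-].
Qed.
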